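(* Fix $\alpha\in[0,\infty]$ with $\alpha\neq1$. The interpretation $\llbracket-\rrbracket$ induces an isomorphism of symmetric monoidal categories between $\mathrm{Syn}(\mathcal{T}_{\mathrm{R}\otimes,\alpha})$ and $\mathsf{BStoch}^\otimes$ which is locally an isometry with respect to $\mathrm{R}^{\max}_\alpha$: for all $n,m$, $[f]\mapsto\llbracket f\rrbracket$ is a well-defined bijection from $\mathrm{Syn}(\mathcal{T}_{\mathrm{R}\otimes,\alpha})(n,m)$ onto all $2^m\times2^n$ stochastic matrices, and $d^{\alpha}(f,g)=\mathrm{R}^{\max}_\alpha(\llbracket f\rrbracket,\llbracket g\rrbracket)$ for all terms $f,g:n\to m$.
   Context: Let $\mathbb{B}=\{0,1\}$. $\mathsf{BStoch}^\otimes$ is the symmetric monoidal category whose objects are natural numbers, whose morphisms $n\to m$ are $2^m\times 2^n$ stochastic matrices, viewed as functions $A:\mathbb{B}^n\to\mathcal{D}(\mathbb{B}^m)$ (finitely supported probability distributions), with matrix-product composition and monoidal product the Kronecker product $(A\otimes B)(uu')=A(u)\otimes B(u')$. Rényi divergence: for distributions $\mu,\nu$ on a finite set $X$ and $0<\alpha<\infty$, $\alpha\neq1$, $\mathrm{R}_\alpha(\mu,\nu)=\frac{1}{\alpha-1}\log\big(\sum_{x}\frac{\mu(x)^\alpha}{\nu(x)^{\alpha-1}}\big)$, where $\frac{x}{0}$ is $0$ if $x=0$ and $\infty$ otherwise, and $\log\infty=\infty$; $\mathrm{R}_0(\mu,\nu)=-\log\sum_{x:\mu(x)>0}\nu(x)$;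 $\mathrm{R}_\infty(\mu,\nu)=\sup_x\log\frac{\mu(x)}{\nu(x)}$. For $A,B:n\to m$, $\mathrm{R}^{\max}_\alpha(A,B)=\max_{u\in\mathbb{B}^n}\mathrm{R}_\alpha(A(u),B(u))$. Define $C_\alpha:[0,1]^2\times[0,\infty]^2\to[0,\infty]$ by $C_\alpha(p,q,\varepsilon,\delta)=\frac{1}{\alpha-1}\log\big(\frac{p^\alpha}{q^{\alpha-1}}e^{(\alpha-1)\varepsilon}+\frac{(1-p)^\alpha}{(1-q)^{\alpha-1}}e^{(\alpha-1)\delta}\big)$ for $0\le\alpha<\infty$, and $C_\infty(p,q,\varepsilon,\delta)=\max\{\log\frac pq+\varepsilon,\log\frac{1-p}{1-q}+\delta\}$. $\Sigma_{\mathrm{Circ}}$ is the monoidal signature with a single sort and generators discard $1\to 0$, copy $1\to 2$, and $2\to 1$, not $1\to1$, $\mathrm{flip}_p:0\to1$ ($p\in[0,1]$); terms are built with identities, symmetries, $;$ and $\otimes$, modulo the laws of symmetric strict monoidal categories. $\llbracket-\rrbracket$ is the symmetric monoidal functor into $\mathsf{BStoch}^\otimes$ with copy $b\mapsto\delta_{bb}$, and $(a,b)\mapsto\delta_{a\wedge b}$, not $b\mapsto\delta_{\neg b}$, $\mathrm{flip}_p\mapsto p\delta_1+(1-p)\delta_0$, discard the unique map to $\mathcal{D}(\mathbb{B}^0)$. $\mathcal{T}_{\mathrm{Circ}}$ is the monoidal theory of causal circuits of Piedeleu et al.: a fixed set of equations such that (known result) two terms are equal modulo the congruence generated by these equations and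 the monoidal laws iff they have the same interpretation, and every morphism of $\mathsf{BStoch}^\otimes$ is the interpretation of a term. $\mathrm{if}_n:1+n+n\to n$ is a fixed term with $\llbracket\mathrm{if}_n\rrbracket(x,u,v)=\delta_u$ if $x=1$, $\delta_v$ if $x=0$. For $f_1,f_0:0\to m$, $D_p(f_1,f_0)=(\mathrm{flip}_p\otimes f_1\otimes f_0);(\mathrm{copy}\otimes\mathrm{id}_m\otimes\mathrm{id}_m);(\mathrm{id}_1\otimes\mathrm{if}_m)$. The theory $\mathcal{T}_{\mathrm{R}\otimes,\alpha}$ over $\Sigma_{\mathrm{Circ}}$ has as axioms: every equation of $\mathcal{T}_{\mathrm{Circ}}$ (no premises); $f=_0f$ for every term; (Chain$_\otimes$) for all $f_1,g_1,f_0,g_0:0\to m$, $p,q\in[0,1]$, $\varepsilon,\delta\in[0,\infty]$: from $f_1=_\varepsilon g_1$ and $f_0=_\delta g_0$ infer $D_p(f_1,f_0)=_{C_\alpha(p,q,\varepsilon,\delta)}D_q(g_1,g_0)$; (Ifmax) for $f_1,g_1:n\to m$, $f_0,g_0:n'\to m$: from $f_1=_\varepsilon g_1$ and $f_0=_\delta g_0$ infer $(\mathrm{id}_1\otimes f_1\otimes f_0);\mathrm{if}_m=_{\max\{\varepsilon,\delta\}}(\mathrm{id}_1\otimes g_1\otimes g_0);\mathrm{if}_m$. Derivability ($\vdash$) means existence of a well-founded (possibly infinitely branching) proof tree with no open leaves using: the axioms; reflexivity, symmetry, transitivity of $=$ and its congruence with $;$ and $\otimes$; the monoidal laws as equations;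 replacement of a term by an equal one in either side of $f=_\varepsilon g$; monotonicity (from $f=_\varepsilon g$ infer $f=_{\varepsilon'}g$ for $\varepsilon\le\varepsilon'$); continuity (from $f=_{\varepsilon_i}g$ for all $i$ infer $f=_{\inf_i\varepsilon_i}g$); nonexpansiveness (from $f=_\varepsilon f'$, $g=_\delta g'$ infer $f;g=_{\varepsilon+\delta}f';g'$ and $f\otimes g=_{\varepsilon+\delta}f'\otimes g'$). $\mathrm{Syn}(\mathcal{T}_{\mathrm{R}\otimes,\alpha})$ has hom-sets of terms modulo $f\equiv g\iff\ \vdash f=g$, with distance $d^{\alpha}(f,g)=\inf\{\varepsilon\mid\ \vdash f=_\varepsilon g\}$.
   Formalization: In C_α the undefined expressions are fixed: for α=0, 0^0 is read as 0 (with 0^0=1, Chain⊗ at p=0, q=1/2, ε=δ=0 would give flip_0 =_0 flip_{1/2}, though R_0=log 2); 0·∞ is read as 0, and log 0+∞ in C_∞ as −∞. *)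

(* Defs.v *)
From HB Require Import structures.
From mathcomp Require Import all_boot all_order all_algebra.
From mathcomp Require Import interval_inference.
From mathcomp Require Import all_classical all_reals all_analysis.

Set Implicit Arguments.
Unset Strict Implicit.
Unset Printing Implicit Defensive.

Import Order.TTheory GRing.Theory Num.Theory.

(* Transport of a morphism along equalities of its source and target.  It is
   needed because [n + (m + k)] and [n + m + k] are equal objects but not
   convertible terms. *)
Definition hcast (H : nat -> nat -> Type) n n' m m' (en : n = n') (em : m = m')
    (f : H n m) : H n' m' :=
  ecast k (H n' k) em (ecast k (H k m) en f).

Record smc_data := SmcData {
  hom :> nat -> nat -> Type;
  idm : forall n, hom n n;
  comp : forall n m k, hom n m -> hom m k -> hom n k;  (* diagrammatic order *)
  tens : forall n m n' m', hom n m -> hom n' m' -> hom (n + n') (m + m');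
  symm : forall n m, hom (n + m) (m + n) }.

Arguments idm {s} n%_N.
Arguments comp {s n m k} f g.
Arguments tens {s n m n' m'} f g.
Arguments symm {s} (n m)%_N.

Declare Scope smc_scope.
Delimit Scope smc_scope with smc.
Local Open Scope smc_scope.
Notation "f ;; g" := (comp f g)
  (at level 50, left associativity, format "f  ;;  g") : smc_scope.
Notation "f ⊗ g" := (tens f g)
  (at level 40, left associativity, format "f  ⊗  g") : smc_scope.

(* The laws of strict symmetric monoidal categories, as a family of pairs of
   parallel morphisms: it is used both to state that a category satisfies them
   and to generate the congruence on terms. *)
Inductive smc_law (C : smc_data) : forall n m, C n m -> C n m -> Prop :=
| law_id_comp n m (f : C n m) : smc_law (idm n ;; f) f
| law_comp_id n m (f : C n m) : smc_law (f ;; idm m) f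
| law_compA n m k l (f : C n m) (g : C m k) (h : C k l) :
    smc_law (f ;; (g ;; h)) (f ;; g ;; h)
| law_tens_id n m : smc_law (idm n ⊗ idm m) (idm (n + m) : C _ _)
| law_interchange n m k n' m' k'
    (f : C n m) (g : C m k) (f' : C n' m') (g' : C m' k') :
    smc_law ((f ;; g) ⊗ (f' ;; g')) (f ⊗ f' ;; g ⊗ g')
| law_tensA n1 m1 n2 m2 n3 m3 (f : C n1 m1) (g : C n2 m2) (h : C n3 m3) :
    smc_law (hcast (addnA n1 n2 n3) (addnA m1 m2 m3) (f ⊗ (g ⊗ h)))
            (f ⊗ g ⊗ h)
| law_unit_tens n m (f : C n m) : @smc_law C n m (idm 0 ⊗ f) f
| law_tens_unit n m (f : C n m) :
    smc_law (hcast (addn0 n) (addn0 m) (f ⊗ idm 0)) f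
| law_symm_nat n m n' m' (f : C n m) (g : C n' m') :
    smc_law (f ⊗ g ;; symm m m') (symm n n' ;; g ⊗ f)
| law_symmK n m : smc_law (symm n m ;; symm m n) (idm (n + m) : C _ _)
| law_symm_unit n : @smc_law C n n (hcast (addn0 n) erefl (symm n 0)) (idm n)
| law_hexagon n m k :
    smc_law (hcast (esym (addnA n m k)) (addnA m k n)
               (hcast erefl (esym (addnA m n k)) (symm n m ⊗ idm k) ;;
                idm m ⊗ symm n k))
            (symm n (m + k) : C _ _).

Record smcat := Smcat {
  smcat_data :> smc_data;
  smcatP : forall n m (f g : smcat_data n m), smc_law f g -> f = g }.

(* Isomorphisms that are the identity on objects. *)
Record smc_iso (C D : smcat) := SmcIso {
  iso_map :> forall n m, C n m -> D n m;
  iso_bij : forall n m, bijective (@iso_map n m);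
  iso_idm : forall n, iso_map (idm n) = idm n;
  iso_comp : forall n m k (f : C n m) (g : C m k),
    iso_map (f ;; g) = iso_map f ;; iso_map g;
  iso_tens : forall n m n' m' (f : C n m) (g : C n' m'),
    iso_map (f ⊗ g) = iso_map f ⊗ iso_map g;
  iso_symm : forall n m, iso_map (symm n m) = symm n m }.

Local Open Scope ring_scope.

Section Distributions.
Variable R : realType.
Implicit Types T U : finType.

Record distr T := Distr {
  dval :> {ffun T -> R};
  _ : [forall x, 0 <= dval x] && (\sum_x dval x == 1) }.

HB.instance Definition _ T := [isSub for @dval T].

Lemma distr_ge0 T (d : distr T) x : 0 <= d x.
Proof. by case: d => f /= /andP[/forallP]. Qed.

Lemma distr_sum1 T (d : distr T) : \sum_x d x = 1.
Proof. by case: d => f /= /andP[_ /eqP]. Qed.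

Lemma distrP T (d e : distr T) : (forall x, d x = e x) -> d = e.
Proof. by move=> h; apply/val_inj/ffunP. Qed.

Lemma distr_subproof T (f : {ffun T -> R}) :
  (forall x, 0 <= f x) -> \sum_x f x = 1 ->
  [forall x, 0 <= f x] && (\sum_x f x == 1).
Proof. by move=> f0 ->; rewrite eqxx andbT; apply/forallP. Qed.

Fact dirac_subproof T (x : T) (f := [ffun y => (y == x)%:R : R]) :
  [forall y, 0 <= f y] && (\sum_y f y == 1).
Proof.
apply: distr_subproof => [y|]; first by rewrite ffunE.
rewrite (bigD1 x)//= big1 => [|y /negbTE yx]; rewrite ffunE ?yx// eqxx.
by rewrite addr0.
Qed.
Definition ddirac T (x : T) : distr T := Distr (dirac_subproof x).

Fact dmix_subproof T (p : {i01 R}) (d e : distr T)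
    (f := [ffun x => p%:num * d x + (1 - p%:num) * e x]) :
  [forall y, 0 <= f y] && (\sum_y f y == 1).
Proof.
apply: distr_subproof => [y|].
  by rewrite ffunE addr_ge0// mulr_ge0// ?distr_ge0// subr_ge0.
under eq_bigr do rewrite ffunE.
by rewrite big_split/= -!mulr_sumr !distr_sum1 !mulr1 addrC subrK.
Qed.
Definition dmix T p (d e : distr T) : distr T := Distr (dmix_subproof p d e).

Fact dbind_subproof T U (d : distr T) (k : T -> distr U)
    (f := [ffun y => \sum_x d x * k x y]) :
  [forall y, 0 <= f y] && (\sum_y f y == 1).
Proof.
apply: distr_subproof => [y|].
  by rewrite ffunE sumr_ge0// => x _; rewrite mulr_ge0 ?distr_ge0.
under eq_bigr do rewrite ffunE.
rewrite exchange_big/= -(distr_sum1 d); apply: eq_bigr => x _.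
by rewrite -mulr_sumr distr_sum1 mulr1.
Qed.
Definition dbind T U (d : distr T) (k : T -> distr U) : distr U :=
  Distr (dbind_subproof d k).

Lemma sum_row_mx n m (F : 'rV[bool]_(n + m) -> R) :
  \sum_w F w = \sum_u \sum_v F (row_mx u v).
Proof.
rewrite pair_big/= (reindex (fun uv : 'rV_n * 'rV_m => row_mx uv.1 uv.2))//=.
exists (fun w => (lsubmx w, rsubmx w)) => [[u v] _|w _] /=.
  by rewrite row_mxKl row_mxKr.
by rewrite hsubmxK.
Qed.

Fact dtens_subproof n m (d : distr 'rV[bool]_n) (e : distr 'rV[bool]_m)
    (f := [ffun w => d (lsubmx w) * e (rsubmx w)]) :
  [forall y, 0 <= f y] && (\sum_y f y == 1).
Proof.
apply: distr_subproof => [y|].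
  by rewrite ffunE mulr_ge0 ?distr_ge0.
rewrite sum_row_mx -(distr_sum1 d); apply: eq_bigr => u _.
under eq_bigr do rewrite ffunE row_mxKl row_mxKr.
by rewrite -mulr_sumr distr_sum1 mulr1.
Qed.
Definition dtens n m (d : distr 'rV[bool]_n) (e : distr 'rV[bool]_m) :
    distr 'rV[bool]_(n + m) :=
  Distr (dtens_subproof d e).

End Distributions.

Arguments ddirac {R T} x.

Section BStoch.
Variable R : realType.

(* The entry of the matrix [A] in column [u] and row [v] is [A u v]. *)
Definition stoch n m := {ffun 'rV[bool]_n -> distr R 'rV[bool]_m}.

Definition determ n m (h : 'rV[bool]_n -> 'rV[bool]_m) : stoch n m :=
  [ffun u => ddirac (h u)].

Definition BStoch_data : smc_data := {|
  hom := stoch;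
  idm n := determ id;
  comp n m k (A : stoch n m) (B : stoch m k) := [ffun u => dbind (A u) B];
  tens n m n' m' (A : stoch n m) (B : stoch n' m') :=
    [ffun w => dtens (A (lsubmx w)) (B (rsubmx w))];
  symm n m := determ (fun w => row_mx (rsubmx w) (lsubmx w)) |}.

Lemma stochP n m (A B : stoch n m) : (forall u v, A u v = B u v) -> A = B.
Proof. by move=> h; apply/ffunP => u; apply/distrP. Qed.

Lemma comp_stochE n m k (A : BStoch_data n m) (B : BStoch_data m k) u w :
  (A ;; B : stoch n k) u w = \sum_v (A : stoch n m) u v * (B : stoch m k) v w.
Proof. by rewrite !ffunE. Qed.

Lemma tens_stochE n m n' m' (A : BStoch_data n m) (B : BStoch_data n' m') w z :
  (A ⊗ B : stoch _ _) w z =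
  (A : stoch n m) (lsubmx w) (lsubmx z) *
  (B : stoch n' m') (rsubmx w) (rsubmx z).
Proof. by rewrite !ffunE. Qed.

Lemma determE n m (h : 'rV[bool]_n -> 'rV[bool]_m) u v :
  determ h u v = (v == h u)%:R.
Proof. by rewrite !ffunE. Qed.

Lemma determ_comp n m k (h : 'rV[bool]_n -> 'rV[bool]_m) (B : stoch m k) :
  (determ h : BStoch_data n m) ;; (B : BStoch_data m k) = [ffun u => B (h u)].
Proof.
apply: stochP => u w; rewrite comp_stochE [in RHS]ffunE (bigD1 (h u))//= determE eqxx mul1r.
by rewrite big1 ?addr0// => v /negbTE vh; rewrite determE vh mul0r.
Qed.

Lemma determ_determ n m k (h : 'rV[bool]_n -> 'rV[bool]_m) (g : _ -> 'rV[bool]_k) :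
  (determ h : BStoch_data n m) ;; (determ g : BStoch_data m k) = determ (g \o h).
Proof. by rewrite determ_comp; apply/ffunP => u; rewrite !ffunE. Qed.

Lemma determ_tens n m n' m' (h : 'rV[bool]_n -> 'rV[bool]_m)
    (g : 'rV[bool]_n' -> 'rV[bool]_m') :
  (determ h : BStoch_data n m) ⊗ (determ g : BStoch_data n' m') =
  determ (fun w => row_mx (h (lsubmx w)) (g (rsubmx w))).
Proof.
apply: stochP => w z; rewrite tens_stochE !determE -natrM mulnb.
congr (_%:R); congr nat_of_bool; apply/andP/eqP => [[/eqP <- /eqP <-]|->].
  by rewrite hsubmxK.
by rewrite row_mxKl row_mxKr !eqxx.
Qed.

Lemma hcast_stochE n n' m m' (en : n = n') (em : m = m') (A : stoch n m) u v :
  (@hcast stoch n n' m m' en em A) u v =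
  A (castmx (erefl, esym en) u) (castmx (erefl, esym em) v).
Proof. by move: u v; case: _ / en; case: _ / em => u v; rewrite !castmx_id. Qed.

Lemma hcast_determ n n' m m' (en : n = n') (em : m = m') (h : _ -> _) :
  @hcast stoch n n' m m' en em (determ h) =
  determ (fun u => castmx (erefl, em) (h (castmx (erefl, esym en) u))).
Proof.
apply: stochP => u v; rewrite hcast_stochE !determE; congr (nat_of_bool _)%:R.
by move: u v h; case: _ / en; case: _ / em => u v h; rewrite !castmx_id.
Qed.

Lemma BStochP n m (f g : BStoch_data n m) : smc_law f g -> f = g.
Proof.
case: n m f g / => [n m f|n m f|n m k l f g h|n m|n m k n' m' k' f g f' g'
  |n1 m1 n2 m2 n3 m3 f g h|n m f|n m f|n m n' m' f g|n m|n|n m k].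
- by rewrite determ_comp; apply/ffunP => u; rewrite ffunE.
- apply: stochP => u w; rewrite comp_stochE (bigD1 w)//= determE eqxx mulr1.
  rewrite big1 ?addr0// => v vw.
  by rewrite determE eq_sym (negbTE vw) mulr0.
- apply: stochP => u w; rewrite !comp_stochE.
  under eq_bigr do rewrite comp_stochE mulr_sumr.
  rewrite exchange_big/=; apply: eq_bigr => v _.
  by rewrite comp_stochE mulr_suml; apply: eq_bigr => x _; rewrite mulrA.
- by rewrite determ_tens; apply/ffunP => u; rewrite !ffunE hsubmxK.
- apply: stochP => u w; rewrite tens_stochE !comp_stochE sum_row_mx mulr_suml.
  apply: eq_bigr => x _; rewrite mulr_sumr; apply: eq_bigr => y _.
  by rewrite !tens_stochE !row_mxKl !row_mxKr mulrACA.
- have E a b c (x : 'rV[bool]_(a + b + c)) (y := castmx (erefl, esym (addnA a b c)) x) :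
      [/\ lsubmx y = lsubmx (lsubmx x), lsubmx (rsubmx y) = rsubmx (lsubmx x)
        & rsubmx (rsubmx y) = rsubmx x].
    by split; apply/rowP => i; rewrite !mxE castmxE/= cast_ord_id;
       congr (x _ _); apply/val_inj => //=; rewrite addnA.
  apply: stochP => u w; rewrite hcast_stochE !tens_stochE.
  have [-> -> ->] := E _ _ _ u; have [-> -> ->] := E _ _ _ w.
  by rewrite mulrA.
- apply: stochP => u w; rewrite (tens_stochE (n := 0) (m := 0)) determE.
  have r0 (x y : 'rV[bool]_0) : (x == y) = true.
    by apply/eqP/rowP => -[].
  have rs k (x : 'rV[bool]_(0 + k)) : rsubmx x = x.
    by apply/rowP => i; rewrite mxE; congr (x _ _); apply/val_inj.
  by rewrite r0 mul1r !rs.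
- apply: stochP => u w; rewrite hcast_stochE tens_stochE determE.
  have r0 (x y : 'rV[bool]_0) : (x == y) = true.
    by apply/eqP/rowP => -[].
  have ls k (x : 'rV[bool]_k) : lsubmx (castmx (erefl, esym (addn0 k)) x) = x.
    by apply/rowP => i; rewrite mxE castmxE; congr (x _ _); apply/val_inj.
  by rewrite r0 mulr1 !ls.
- rewrite determ_comp; apply: stochP => u w; rewrite [in RHS]ffunE comp_stochE.
  rewrite (bigD1 (row_mx (rsubmx w) (lsubmx w)))//= big1 => [|v vw].
    rewrite addr0 !tens_stochE determE !row_mxKl !row_mxKr hsubmxK eqxx.
    by rewrite mulr1 mulrC.
  rewrite determE; case: eqP => [wE|]; last by rewrite mulr0.
  by case/eqP: vw; rewrite wE row_mxKl row_mxKr hsubmxK.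
- rewrite determ_determ; apply/ffunP => u.
  by rewrite !ffunE/= row_mxKl row_mxKr hsubmxK.
- rewrite hcast_determ; apply/ffunP => u; rewrite !ffunE; congr ddirac.
  apply/rowP => i; rewrite castmx_id.
  transitivity (row_mx (rsubmx (castmx (erefl, esym (addn0 n)) u))
                       (lsubmx (castmx (erefl, esym (addn0 n)) u)) 0 (rshift 0 i)).
    by congr (row_mx _ _ _ _); apply/val_inj.
  by rewrite row_mxEr mxE castmxE; congr (u _ _); apply/val_inj.
- rewrite determ_tens determ_tens hcast_determ determ_determ hcast_determ.
  apply/ffunP => u; rewrite !ffunE/=; congr ddirac.
  rewrite castmx_id; set x := castmx (_, _) u.
  apply/rowP => i; rewrite castmxE cast_ord_id.
  case: (splitP i) => [j|j] ij.
    case: (splitP j) => [a|a] ja.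
      have -> : i = lshift n (lshift k a) by apply/val_inj; rewrite /= ij ja.
      set i' := cast_ord _ _.
      have -> : i' = lshift (k + n) a by apply/val_inj.
      rewrite row_mxEl row_mxEl !mxE castmxE/= cast_ord_id.
      set a' := cast_ord _ _.
      have -> : a' = lshift k (lshift n a) by apply/val_inj.
      rewrite row_mxEl row_mxEl !mxE /x castmxE/= cast_ord_id.
      by congr (u _ _); apply/val_inj => /=.
    have -> : i = lshift n (rshift m a) by apply/val_inj; rewrite /= ij ja.
    set i' := cast_ord _ _.
    have -> : i' = rshift m (lshift n a) by apply/val_inj.
    rewrite row_mxEl row_mxEr row_mxEl !mxE castmxE/= cast_ord_id.
    set a' := cast_ord _ _.
    have -> : a' = rshift (m + n) a by apply/val_inj => /=; rewrite addnA.
    rewrite row_mxEr !mxE /x castmxE/= cast_ord_id.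
    by congr (u _ _); apply/val_inj => /=; rewrite addnA.
  have -> : i = rshift (m + k) j by apply/val_inj.
  set i' := cast_ord _ _.
  have -> : i' = rshift m (rshift k j) by apply/val_inj => /=; rewrite addnA.
  rewrite row_mxEr row_mxEr row_mxEr !mxE castmxE/= cast_ord_id.
  set a' := cast_ord _ _.
  have -> : a' = lshift k (rshift m j) by apply/val_inj.
  rewrite row_mxEl row_mxEr !mxE /x castmxE/= cast_ord_id.
  by congr (u _ _); apply/val_inj => /=.
Qed.

Definition BStoch : smcat := Smcat BStochP.

End BStoch.

Section Circuits.
Variable R : realType.
Local Open Scope nat_scope.

Inductive term : nat -> nat -> Type :=
| Tid n : term n n
| Tcomp n m k : term n m -> term m k -> term n k
| Ttens n m n' m' : term n m -> term n' m' -> term (n + n') (m + m')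
| Tsymm n m : term (n + m) (m + n)
| Discard : term 1 0
| Copy : term 1 2
| And : term 2 1
| Not : term 1 1
| Flip of {i01 R} : term 0 1.

Definition Term : smc_data :=
  {| hom := term; idm := Tid; comp := Tcomp; tens := Ttens; symm := Tsymm |}.

Definition bit (b : bool) : 'rV[bool]_1 := const_mx b.

Fixpoint sem n m (f : term n m) : BStoch R n m :=
  match f with
  | Tid n => idm n
  | Tcomp _ _ _ f g => sem f ;; sem g
  | Ttens _ _ _ _ f g => sem f ⊗ sem g
  | Tsymm n m => symm n m
  | Discard => determ R (fun=> 0%R : 'rV[bool]_0)
  | Copy => determ R (fun u : 'rV[bool]_1 => row_mx u u : 'rV[bool]_2)
  | And => determ R (fun u : 'rV[bool]_2 => bit (u 0%R 0%R && u 0%R 1%R))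
  | Not => determ R (fun u : 'rV[bool]_1 => bit (~~ u 0%R 0%R))
  | Flip p => [ffun=> dmix p (ddirac (bit true)) (ddirac (bit false))]
  end.

Inductive eqth (E : forall n m, term n m -> term n m -> Prop) :
    forall n m, term n m -> term n m -> Prop :=
| eqth_ax n m (f g : term n m) : E n m f g -> eqth E f g
| eqth_law n m (f g : term n m) : @smc_law Term n m f g -> eqth E f g
| eqth_refl n m (f : term n m) : eqth E f f
| eqth_sym n m (f g : term n m) : eqth E f g -> eqth E g f
| eqth_trans n m (f g h : term n m) : eqth E f g -> eqth E g h -> eqth E f h
| eqth_comp n m k (f f' : term n m) (g g' : term m k) :
    eqth E f f' -> eqth E g g' -> eqth E (Tcomp f g) (Tcomp f' g')
| eqth_tens n m n' m' (f f' : term n m) (g g' : term n' m') :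
    eqth E f f' -> eqth E g g' -> eqth E (Ttens f g) (Ttens f' g').

HB.instance Definition _ n m := gen_eqMixin (term n m).
HB.instance Definition _ n m := gen_choiceMixin (term n m).

End Circuits.

Arguments term R (n m)%_N : rename.
Arguments Discard {R}.
Arguments Copy {R}.
Arguments And {R}.
Arguments Not {R}.
Arguments Tid {R} n%_N.
Arguments Tsymm {R} n m.

Section Syn.
Variables (R : realType) (E : forall n m, term R n m -> term R n m -> Prop).
Local Open Scope quotient_scope.

Definition eqthb n m : rel (term R n m) := fun f g => `[< eqth E f g >].

Fact eqthb_refl n m : reflexive (@eqthb n m).
Proof. by move=> f; apply/asboolP/eqth_refl. Qed.

Fact eqthb_sym n m : symmetric (@eqthb n m).
Proof. by move=> f g; apply/asboolP/asboolP => /eqth_sym. Qed.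

Fact eqthb_trans n m : transitive (@eqthb n m).
Proof.
by move=> g f h /asboolP fg /asboolP gh; apply/asboolP/(eqth_trans fg gh).
Qed.

Canonical eqthb_equiv n m :=
  EquivRel (@eqthb n m) (@eqthb_refl n m) (@eqthb_sym n m) (@eqthb_trans n m).

Definition syn n m := {eq_quot @eqthb n m}.

Definition synpi n m (f : term R n m) : syn n m := \pi f.

Lemma synpiP n m (f g : term R n m) : synpi f = synpi g <-> eqth E f g.
Proof.
split=> [/eqquotP/asboolP//|fg].
by apply/eqquotP/asboolP.
Qed.

Lemma eqth_repr n m (f : term R n m) : eqth E (repr (synpi f)) f.
Proof. by apply/synpiP; rewrite /synpi reprK. Qed.

Definition Syn_data : smc_data := {|
  hom := syn;
  idm n := synpi (Tid n);
  comp n m k (f : syn n m) (g : syn m k) := synpi (Tcomp (repr f) (repr g));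
  tens n m n' m' (f : syn n m) (g : syn n' m') :=
    synpi (Ttens (repr f) (repr g));
  symm n m := synpi (Tsymm n m) |}.

Lemma synpi_comp n m k (f : term R n m) (g : term R m k) :
  (synpi f : Syn_data n m) ;; (synpi g : Syn_data m k) = synpi (Tcomp f g).
Proof. by apply/synpiP/eqth_comp; apply: eqth_repr. Qed.

Lemma synpi_tens n m n' m' (f : term R n m) (g : term R n' m') :
  (synpi f : Syn_data n m) ⊗ (synpi g : Syn_data n' m') = synpi (Ttens f g).
Proof. by apply/synpiP/eqth_tens; apply: eqth_repr. Qed.

Lemma hcast_synpi n n' m m' (en : n = n') (em : m = m') (f : term R n m) :
  hcast (H := syn) en em (synpi f) = synpi (hcast (H := term R) en em f).
Proof. by case: _ / en; case: _ / em. Qed.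

Lemma SynP n m (f g : Syn_data n m) : smc_law f g -> f = g.
Proof.
have P a b (x : Syn_data a b) : exists f : term R a b, x = synpi f.
  by exists (repr x); rewrite /synpi reprK.
have iE k : idm k = synpi (Tid k) :> Syn_data _ _ by [].
have sE k l : symm k l = synpi (Tsymm k l) :> Syn_data _ _ by [].
have L a b (x y : term R a b) : eqth E x y -> synpi x = synpi y.
  by move/synpiP.
have law := @eqth_law R E.
case: n m f g / => [n m f|n m f|n m k l f g h|n m|n m k n' m' k' f g f' g'
  |n1 m1 n2 m2 n3 m3 f g h|n m f|n m f|n m n' m' f g|n m|n|n m k].
- by have [f' ->] := P _ _ f; rewrite iE synpi_comp; apply/L/law/law_id_comp.
- by have [f' ->] := P _ _ f; rewrite iE synpi_comp; apply/L/law/law_comp_id.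
- have [f' ->] := P _ _ f; have [g' ->] := P _ _ g; have [h' ->] := P _ _ h.
  by rewrite !synpi_comp; apply/L/law/law_compA.
- by rewrite !iE synpi_tens; apply/L/law/law_tens_id.
- have [a ->] := P _ _ f; have [b ->] := P _ _ g.
  have [c ->] := P _ _ f'; have [d ->] := P _ _ g'.
  by rewrite !(synpi_comp, synpi_tens); apply/L/law/law_interchange.
- have [f' ->] := P _ _ f; have [g' ->] := P _ _ g; have [h' ->] := P _ _ h.
  by rewrite !synpi_tens hcast_synpi; apply/L/law/law_tensA.
- have [f' ->] := P _ _ f; rewrite iE synpi_tens.
  exact/L/law/law_unit_tens.
- have [f' ->] := P _ _ f.
  by rewrite iE synpi_tens hcast_synpi; apply/L/law/law_tens_unit.
- have [f' ->] := P _ _ f; have [g' ->] := P _ _ g.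
  by rewrite !sE !(synpi_comp, synpi_tens); apply/L/law/law_symm_nat.
- by rewrite !sE synpi_comp; apply/L/law/law_symmK.
- by rewrite sE hcast_synpi; apply/L/law/law_symm_unit.
- rewrite !sE !iE !synpi_tens (hcast_synpi erefl) synpi_comp hcast_synpi.
  exact/L/law/law_hexagon.
Qed.

Definition Syn : smcat := Smcat SynP.

End Syn.

Section Renyi.
Variable R : realType.
Local Open Scope ereal_scope.
Local Open Scope classical_set_scope.

(* Real powers of [x >= 0] with [0^a = +oo] for [a < 0] and [0^0 = 0]; the
   latter makes [p^0] the indicator of [p > 0], the limit of [p^a] as [a] tends
   to [0] from above. *)
Definition rpow (x a : R) : \bar R :=
  if x == 0%R then (if (a < 0)%R then +oo else 0) else (x `^ a)%:E.

(* In [\bar R] the library has [0^-1 = +oo], [+oo^-1 = 0] and [0 * +oo = 0], so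
   that [x / 0] is [0] if [x = 0] and [+oo] if [x > 0]; moreover [lne 0 = -oo]
   and, relevant for [chain_cost] at [p = 0] or [p = 1], [-oo + +oo = -oo].  The
   value at [alpha = -oo] is irrelevant. *)
Definition renyi (alpha : \bar R) (T : finType) (mu nu : distr R T) : \bar R :=
  match alpha with
  | a%:E =>
    if a == 0%R then - lne (\sum_(x | (0 < mu x)%R) nu x)%:E
    else (a - 1)^-1%:E * lne (\sum_x rpow (mu x) a / rpow (nu x) (a - 1))
  | +oo => ereal_sup (range (fun x => lne ((mu x)%:E / (nu x)%:E)))
  | -oo => 0
  end.

Definition renyi_max (alpha : \bar R) n m (A B : BStoch R n m) : \bar R :=
  \big[maxe/-oo]_(u : 'rV[bool]_n)
    renyi alpha ((A : stoch R n m) u) ((B : stoch R n m) u).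

Definition chain_cost (alpha : \bar R) (p q : {i01 R}) (e d : \bar R) : \bar R :=
  match alpha with
  | a%:E =>
    (a - 1)^-1%:E *
    lne (rpow p%:num a / rpow q%:num (a - 1) * expeR ((a - 1)%:E * e) +
         rpow (1 - p%:num) a / rpow (1 - q%:num) (a - 1)
           * expeR ((a - 1)%:E * d))
  | +oo => maxe (lne (p%:num%:E / q%:num%:E) + e)
                (lne ((1 - p%:num)%:E / (1 - q%:num)%:E) + d)
  | -oo => 0
  end.

End Renyi.

Section QuantitativeTheory.
Variables (R : realType) (alpha : \bar R).
Variable E : forall n m, term R n m -> term R n m -> Prop.
Variable ifT : forall n, term R (1 + n + n) n.
Local Open Scope ereal_scope.
Local Open Scope classical_set_scope.

Definition branch (p : {i01 R}) m (f1 f0 : Term R 0%N m) : Term R 0%N (1 + m)%N :=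
  ((Flip p : Term R 0%N 1%N) ⊗ f1 ⊗ f0 : Term R 0%N (1 + m + m)%N) ;;
  ((Copy : Term R 1%N 2%N) ⊗ idm m ⊗ idm m) ;;
  (idm 1 ⊗ (ifT m : Term R _ _)).

(* [qeq e f g] is derivability of [f =_e g].  No rule has an equation as
   conclusion and a distance judgement as premise, so the derivable equations
   are exactly those of [eqth E].  The family in [qeq_cont] may be empty, with
   infimum [+oo]. *)
Inductive qeq : forall n m, \bar R -> Term R n m -> Term R n m -> Prop :=
| qeq_refl n m (f : Term R n m) : qeq 0 f f
| qeq_chain m (f1 g1 f0 g0 : Term R 0%N m) (p q : {i01 R}) (e d : \bar R) :
    0 <= e -> 0 <= d -> qeq e f1 g1 -> qeq d f0 g0 ->
    qeq (chain_cost alpha p q e d) (branch p f1 f0) (branch q g1 g0)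
| qeq_ifmax n n' m (f1 g1 : Term R n m) (f0 g0 : Term R n' m) (e d : \bar R) :
    0 <= e -> 0 <= d -> qeq e f1 g1 -> qeq d f0 g0 ->
    qeq (maxe e d) (idm 1 ⊗ f1 ⊗ f0 ;; (ifT m : Term R _ _))
                   (idm 1 ⊗ g1 ⊗ g0 ;; (ifT m : Term R _ _))
| qeq_subst n m (e : \bar R) (f f' g g' : Term R n m) :
    eqth E f f' -> eqth E g g' -> qeq e f g -> qeq e f' g'
| qeq_mono n m (e e' : \bar R) (f g : Term R n m) :
    e <= e' -> qeq e f g -> qeq e' f g
| qeq_cont n m (I : Type) (e : I -> \bar R) (f g : Term R n m) :
    (forall i, qeq (e i) f g) -> qeq (ereal_inf (range e)) f g
| qeq_comp n m k (e d : \bar R) (f f' : Term R n m) (g g' : Term R m k) :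
    qeq e f f' -> qeq d g g' -> qeq (e + d) (f ;; g) (f' ;; g')
| qeq_tens n m n' m' (e d : \bar R)
    (f f' : Term R n m) (g g' : Term R n' m') :
    qeq e f f' -> qeq d g g' -> qeq (e + d) (f ⊗ g) (f' ⊗ g').

Definition syn_dist n m (f g : term R n m) : \bar R :=
  ereal_inf [set e | 0 <= e /\ qeq e f g].

End QuantitativeTheory.

(* Main.v *)
Require Import Defs.
From mathcomp Require Import all_boot all_order all_algebra.
From mathcomp Require Import interval_inference ring.
From mathcomp Require Import all_classical all_reals all_analysis.

Set Implicit Arguments.
Unset Strict Implicit.
Unset Printing Implicit Defensive.

Import Order.TTheory GRing.Theory Num.Theory.

Local Open Scope ring_scope.

(* Soundness: judgement by judgement, every rule bounds the max-divergence of the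
   interpretations.  Sequential composition and tensor are instances of the
   composition bound for [dbind], itself the joint chain rule followed by data
   processing; the latter is the sub- or superadditivity of (x, y) |-> x^a y^(1-a).

   Completeness: for a distribution on m+1 bits, condition on the first bit; the
   chain rule is an equality, so (Chain) derives exactly the divergence once the
   conditionals are handled by induction.  A circuit with n+1 inputs is a case
   distinction on its first input, and (Ifmax) gives the maximum over inputs. *)

(** * Power inequalities and the summands of the divergence sum *)

Section Powers.
Variable R : realType.
Implicit Types a x y : R.

(** Hölder's inequality for two terms, with conjugate exponents [a^-1] and [(1 - a)^-1]. *)
Lemma powR_concave a x x' y y' : 0 < a < 1 ->
  0 <= x -> 0 <= x' -> 0 <= y -> 0 <= y' ->
  x `^ a * y `^ (1 - a) + x' `^ a * y' `^ (1 - a) <=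
  (x + x') `^ a * (y + y') `^ (1 - a).
Proof.
move=> /andP[a0 a1] x0 x'0 y0 y'0.
have b0 : 0 < 1 - a by rewrite subr_gt0.
have := @hoelder2 R (x `^ a) (x' `^ a) (y `^ (1 - a)) (y' `^ (1 - a))
  a^-1 (1 - a)^-1.
rewrite !powR_ge0 !invr_gt0 a0 b0 !invrK -!powRrM !mulfV ?gt_eqF// !powRr1//.
by apply=> //; rewrite addrC subrK.
Qed.

(** Jensen's inequality for the power [a] at the ratios [x / y] and [x' / y'], with weights
    proportional to [y] and [y']; the result is multiplied by [y + y']. *)
Lemma powR_convex a x x' y y' : 1 < a ->
  0 <= x -> 0 <= x' -> 0 < y -> 0 < y' ->
  (x + x') `^ a * (y + y') `^ (1 - a) <=
  x `^ a * y `^ (1 - a) + x' `^ a * y' `^ (1 - a).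
Proof.
move=> a1 x0 x'0 y0 y'0.
have s0 : 0 < y + y' by rewrite addr_gt0.
have E u v : 0 <= u -> 0 < v -> v * (u / v) `^ a = u `^ a * v `^ (1 - a).
  move=> u0 v0; have v0' := ltW v0.
  rewrite powRM ?invr_ge0// -powR_inv1// -powRrM mulN1r.
  rewrite mulrCA; congr (_ * _).
  by rewrite -[X in X * _ = _]powRr1// -powRD// (gt_eqF v0) implybT.
have t1 : 0 <= y / (y + y') <= 1.
  by rewrite divr_ge0 ?(ltW y0) ?(ltW s0)//= ler_pdivrMr// mul1r lerDl ltW.
case/andP: t1 => t0 t1.
have := @convex_powR R a (ltW a1) (Itv01 t0 t1) (x / y) (x' / y').
rewrite !inE/= !in_itv/= !divr_ge0 ?(ltW y0) ?(ltW y'0)// => /(_ isT isT).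
rewrite convRE [X in X `^ _ <= _]convRE/= /unstable.onem.
have -> : 1 - y / (y + y') = y' / (y + y') by field; rewrite gt_eqF.
have -> : y / (y + y') * (x / y) + y' / (y + y') * (x' / y') = (x + x') / (y + y').
  by field; rewrite !gt_eqF.
have F v w : (y + y') * (v / (y + y') * w) = v * w by field; rewrite gt_eqF.
by rewrite -(ler_pM2l s0) E ?addr_ge0// mulrDr !F !E.
Qed.

Local Open Scope ereal_scope.

(** On positive arguments this is [x ^ a * y ^ (1 - a)]. At [y = 0 < x] it is [0] for [a < 1] and
    [+oo] for [a > 1]. *)
Definition kern (a : R) (x y : R) : \bar R := rpow x a / rpow y (a - 1).

(* The factor [1 / (a - 1)] in the divergence of order [a] is negative for
   [a < 1], so bounds on the sum inside the logarithm are reversed there. *)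
Definition leA (a : R) (s t : \bar R) := if (a < 1)%R then t <= s else s <= t.

Lemma rpow_ge0 x a : 0 <= rpow x a.
Proof.
by rewrite /rpow; case: ifP => // _; [case: ifP|rewrite lee_fin powR_ge0].
Qed.

Lemma kern_ge0 a x y : 0 <= kern a x y.
Proof. by rewrite mule_ge0// ?inve_ge0 rpow_ge0. Qed.

Lemma kern0 a y : (0 <= a)%R -> kern a 0 y = 0.
Proof. by move=> a0; rewrite /kern /rpow eqxx ltNge a0 mul0e. Qed.

Lemma kern_gt0 a x y : (0 < x)%R -> (0 < y)%R ->
  kern a x y = (x `^ a * y `^ (1 - a))%:E.
Proof.
move=> x0 y0; rewrite /kern /rpow !gt_eqF// inver gt_eqF ?powR_gt0//.
by rewrite -powRN opprB EFinM.
Qed.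

Lemma kernx0_lt1 a x : (a < 1)%R -> kern a x 0 = 0.
Proof. by move=> a1; rewrite /kern {2}/rpow eqxx subr_lt0 a1 invey mule0. Qed.

Lemma kernx0_gt1 a x : (1 < a)%R -> (0 < x)%R -> kern a x 0 = +oo.
Proof.
move=> a1 x0; rewrite /kern /rpow eqxx gt_eqF// ltNge subr_ge0 (ltW a1)/=.
by rewrite inve0 gt0_muley// lte_fin powR_gt0.
Qed.

Lemma kern_lt1 a x y : (a < 1)%R -> (0 < x)%R -> (0 <= y)%R ->
  kern a x y = (x `^ a * y `^ (1 - a))%:E.
Proof.
move=> a1 x0; rewrite le_eqVlt => /predU1P[<-|]; last exact: kern_gt0.
by rewrite kernx0_lt1// powR0 ?mulr0// subr_eq0 gt_eqF.
Qed.

Lemma kern_gt1 a x y : (1 < a)%R -> (0 <= x)%R -> (0 < y)%R ->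
  kern a x y = (x `^ a * y `^ (1 - a))%:E.
Proof.
move=> a1; have a0 : (0 < a)%R by rewrite (lt_trans _ a1).
rewrite le_eqVlt => /predU1P[<- _|]; last exact: kern_gt0.
by rewrite kern0 ?(ltW a0)// powR0 ?gt_eqF// mul0r.
Qed.

Lemma kern_diag a x : (0 <= a)%R -> (0 <= x)%R -> kern a x x = x%:E.
Proof.
move=> a0; rewrite le_eqVlt => /predU1P[<-|x0]; first exact: kern0.
rewrite kern_gt0// -powRD; last by rewrite (gt_eqF x0) implybT.
by rewrite addrCA subrr addr0 powRr1// ltW.
Qed.

(** The source of the chain rule as an equality. Once [x] and [x'] are positive and [a > 1], both
    kernels are positive or [+oo], so [0 * +oo] does not arise. *)
Lemma kernM a x x' y y' : (0 <= a)%R -> a != 1%R ->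
  (0 <= x)%R -> (0 <= x')%R -> (0 <= y)%R -> (0 <= y')%R ->
  kern a (x * x') (y * y') = kern a x y * kern a x' y'.
Proof.
move=> a0 an1; rewrite le_eqVlt => /predU1P[<- *|x0].
  by rewrite mul0r !kern0// mul0e.
rewrite le_eqVlt => /predU1P[<- *|x'0]; first by rewrite mulr0 !kern0// mule0.
case: (ltgtP a 1%R) an1 => // a1 _ y0 y'0.
  rewrite !kern_lt1 ?mulr_gt0// ?mulr_ge0// -EFinM !powRM ?(ltW x0) ?(ltW x'0)//.
  by rewrite mulrACA.
move: y0; rewrite le_eqVlt => /predU1P[<-|y0].
  rewrite mul0r !kernx0_gt1 ?mulr_gt0// gt0_mulye// lt0e kern_ge0 andbT.
  move: y'0; rewrite le_eqVlt => /predU1P[<-|y'0]; first by rewrite kernx0_gt1.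
  by rewrite kern_gt0// eqe gt_eqF// mulr_gt0 ?powR_gt0.
move: y'0; rewrite le_eqVlt => /predU1P[<-|y'0].
  rewrite mulr0 !kernx0_gt1 ?mulr_gt0// gt0_muley// kern_gt0// lte_fin.
  by rewrite mulr_gt0 ?powR_gt0.
rewrite !kern_gt0 ?mulr_gt0// -EFinM !powRM 1?ltW//.
by rewrite mulrACA.
Qed.

(** The two power inequalities, extended to zero arguments. For [a < 1] a summand with [x = 0]
    vanishes and enlarging [y] only increases the other; for [a > 1] a zero [y] under a positive [x]
    makes the sum [+oo]. *)
Lemma kernD a x x' y y' : (0 <= a)%R -> a != 1%R ->
  (0 <= x)%R -> (0 <= x')%R -> (0 <= y)%R -> (0 <= y')%R ->
  leA a (kern a (x + x') (y + y')) (kern a x y + kern a x' y').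
Proof.
move=> a0 an1 x0 x'0 y0 y'0; rewrite /leA; case: (ltgtP a 1%R) an1 => // a1 _.
  have mono z t t' : (0 < z)%R -> (0 <= t)%R -> (0 <= t')%R ->
      (z `^ a * t `^ (1 - a) <= z `^ a * (t + t') `^ (1 - a))%R.
    move=> *; rewrite ler_wpM2l ?powR_ge0// ge0_ler_powR ?subr_ge0 ?(ltW a1)//.
    - by rewrite nnegrE addr_ge0.
    - by rewrite lerDl.
  move: x0; rewrite le_eqVlt => /predU1P[<-|x0].
    rewrite add0r kern0// add0e.
    move: x'0; rewrite le_eqVlt => /predU1P[<-|x'0]; first by rewrite !kern0.
    by rewrite !kern_lt1 ?addr_ge0// lee_fin (addrC y) mono.
  move: x'0; rewrite le_eqVlt => /predU1P[<-|x'0].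
    by rewrite addr0 [kern a 0 _]kern0// adde0 !kern_lt1 ?addr_ge0// lee_fin mono.
  rewrite !kern_lt1 ?addr_gt0 ?addr_ge0// -EFinD lee_fin.
  (* Hölder's inequality needs [a > 0]; at [a = 0] both sides are [y + y']. *)
  move: a0; rewrite le_eqVlt => /predU1P[<-|a0].
    by rewrite !powRr0 !mul1r !subr0 !powRr1 ?addr_ge0.
  by rewrite powR_concave ?a0// ltW.
have P u v t : (0 <= u)%R -> (0 <= v)%R -> (0 <= t)%R ->
    kern a (u + v) (0 + t) <= kern a u 0 + kern a v t.
  move=> u0 v0 t0; move: u0; rewrite le_eqVlt => /predU1P[<-|u0].
    by rewrite !add0r kern0// add0e.
  rewrite [kern a u 0]kernx0_gt1// addye ?leey//.
  by rewrite gt_eqF// (lt_le_trans _ (kern_ge0 _ _ _)).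
move: y0; rewrite le_eqVlt => /predU1P[<-|y0]; first exact: P.
move: y'0; rewrite le_eqVlt => /predU1P[<-|y'0].
  by rewrite (addrC x) (addrC y) addeC P// ltW.
rewrite !kern_gt1 ?addr_gt0 ?addr_ge0// -EFinD lee_fin.
by rewrite powR_convex.
Qed.

Lemma leA_refl a s : leA a s s.
Proof. by rewrite /leA; case: ifP. Qed.

Lemma leA_trans a s t u : leA a s t -> leA a t u -> leA a s u.
Proof.
by rewrite /leA; case: ifP => _ h k; [apply: le_trans h|apply: le_trans k].
Qed.

Lemma leAD a s s' t t' : leA a s s' -> leA a t t' -> leA a (s + t) (s' + t').
Proof. by rewrite /leA; case: ifP => _; exact: leeD. Qed.

Lemma leAM a s t t' : 0 <= s -> leA a t t' -> leA a (s * t) (s * t').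
Proof. by rewrite /leA; case: ifP => _ s0; exact: lee_wpmul2l. Qed.

Lemma leA_sum a (I : Type) (r : seq I) (F G : I -> \bar R) :
  (forall i, leA a (F i) (G i)) -> leA a (\sum_(i <- r) F i) (\sum_(i <- r) G i).
Proof.
move=> h; apply: (big_ind2 (leA a)) => //; first exact: leA_refl.
by move=> *; exact: leAD.
Qed.

(** Merging outcomes can only lower the divergence; both data processing and nonnegativity rest on
    this. *)
Lemma kern_sum a (I : Type) (r : seq I) (F G : I -> R) :
  (0 <= a)%R -> a != 1%R -> (forall i, 0 <= F i)%R -> (forall i, 0 <= G i)%R ->
  leA a (kern a (\sum_(i <- r) F i) (\sum_(i <- r) G i))
        (\sum_(i <- r) kern a (F i) (G i)).
Proof.
move=> a0 a1 F0 G0; elim: r => [|i r IH].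
  by rewrite !big_nil kern0//; exact: leA_refl.
rewrite !big_cons; apply: (leA_trans (t := kern a (F i) (G i) +
  kern a (\sum_(j <- r) F j)%R (\sum_(j <- r) G j)%R)).
  by apply: kernD => //; exact: sumr_ge0.
exact/leAD/IH/leA_refl.
Qed.

End Powers.

(** * Extended logarithm on nonnegative arguments *)

Section Logarithm.
Variable R : realType.
Local Open Scope ereal_scope.

Lemma lneK_ge0 (x : \bar R) : 0 <= x -> expeR (lne x) = x.
Proof. by rewrite -lneK_eq => /eqP. Qed.

Lemma lneM_ge0 (x y : \bar R) : 0 <= x -> 0 <= y -> lne (x * y) = lne x + lne y.
Proof.
move=> x0 y0; apply: expeR_inj; rewrite expeRD.
by rewrite !lneK_ge0 ?mule_ge0.
Qed.

End Logarithm.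

(** * Divergences of finite order *)

Section FiniteOrder.
Variables (R : realType) (a : R).
Hypotheses (a0 : (0 <= a)%R) (a1 : a != 1%R).
Local Open Scope ereal_scope.

(** [expA] carries bounds on divergences to bounds on kernel sums and [logA] carries them back;
    [leA] absorbs the sign of [a - 1]. *)
Definition expA (e : \bar R) := expeR ((a - 1)%:E * e).
Definition logA (s : \bar R) := (a - 1)^-1%:E * lne s.

Let a1_neq0 : (a - 1 != 0)%R. Proof. by rewrite subr_eq0. Qed.

Lemma logAK s : 0 <= s -> expA (logA s) = s.
Proof.
move=> s0; by rewrite /expA /logA muleA -EFinM mulfV// mul1e lneK_ge0.
Qed.

Lemma expA_ge0 e : 0 <= expA e. Proof. exact: expeR_ge0. Qed.

Lemma expA_le e d : leA a (expA e) (expA d) = (e <= d).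
Proof.
rewrite /leA /expA !lee_expeR; case: (ltgtP a 1%R) a1 => // h _.
  by rewrite !leNgt lte_nmul2l// lte_fin subr_lt0.
by rewrite lee_pmul2l// lte_fin subr_gt0.
Qed.

Lemma expAD e d : 0 <= e -> 0 <= d -> expA (e + d) = expA e * expA d.
Proof. by move=> e0 d0; rewrite /expA ge0_muleDr// expeRD. Qed.

Lemma logA_le s e : 0 <= s -> (logA s <= e) = leA a s (expA e).
Proof. by move=> s0; rewrite -expA_le logAK. Qed.

Definition kernS (T : finType) (mu nu : distr R T) :=
  \sum_x kern a (mu x) (nu x).

Lemma kernS_ge0 T (mu nu : distr R T) : 0 <= kernS mu nu.
Proof. by apply: sume_ge0 => x _; exact: kern_ge0. Qed.

(** The separate formula at order 0 fits too: there [kern] is [nu x] where [mu x > 0] and [0]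
    elsewhere, and [(a - 1)^-1] is [-1]. *)
Lemma renyi_logA T (mu nu : distr R T) : renyi a%:E mu nu = logA (kernS mu nu).
Proof.
rewrite /renyi; have [E|//] := eqVneq a 0%R.
rewrite /logA /kernS E sub0r invrN1 EFinN mulN1e -sumEFin big_mkcond/=.
do 2 apply: congr1; apply: eq_bigr => x _.
case: ltgtP (distr_ge0 mu x) => // [mx|<-] _; last by rewrite kern0.
by rewrite kern_lt1 ?distr_ge0// powRr0 mul1r subr0 powRr1 ?distr_ge0.
Qed.

Lemma chain_cost_logA p q e d :
  chain_cost a%:E p q e d =
  logA (kern a p%:num q%:num * expA e + kern a (1 - p%:num) (1 - q%:num) * expA d).
Proof. by []. Qed.

Lemma chain_cost_le_fin p q e d e' d' : e <= e' -> d <= d' ->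
  chain_cost a%:E p q e d <= chain_cost a%:E p q e' d'.
Proof.
have P u v : 0 <= kern a p%:num q%:num * expA u +
    kern a (1 - p%:num) (1 - q%:num) * expA v.
  by apply: adde_ge0; apply: mule_ge0; (exact: kern_ge0 || exact: expA_ge0).
move=> ee dd; rewrite !chain_cost_logA logA_le// logAK//.
by apply: leAD; apply: leAM; rewrite ?kern_ge0 ?expA_le.
Qed.

Lemma renyi_ge0_fin T (mu nu : distr R T) : 0 <= renyi a%:E mu nu.
Proof.
rewrite renyi_logA -expA_le logAK ?kernS_ge0//.
(* Both total masses are 1, so the claim compares the kernel of the totals with the sum of the
   kernels. *)
have -> : expA 0 = kern a (\sum_x mu x)%R (\sum_x nu x)%R.
  by rewrite /expA mule0 expeR0 !distr_sum1 kern_diag.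
by apply: kern_sum => // x; exact: distr_ge0.
Qed.

Lemma renyi_refl_fin T (mu : distr R T) : renyi a%:E mu mu = 0.
Proof.
rewrite renyi_logA /logA /kernS.
under eq_bigr => x do rewrite kern_diag ?distr_ge0//.
by rewrite sumEFin distr_sum1 lne1 mule0.
Qed.

Lemma renyi_bind_fin T U (mu nu : distr R T) (A B : T -> distr R U) e d :
  0 <= e -> 0 <= d -> renyi a%:E mu nu <= e ->
  (forall x, renyi a%:E (A x) (B x) <= d) ->
  renyi a%:E (dbind mu A) (dbind nu B) <= e + d.
Proof.
move=> e0 d0; rewrite !renyi_logA !logA_le ?kernS_ge0// expAD// => h hAB.
(* Data processing: the sum over the intermediate outcome [x] leaves the kernel. *)
apply: (leA_trans (t := \sum_y \sum_x kern a (mu x * A x y) (nu x * B x y))).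
  apply: leA_sum => y; rewrite !ffunE.
  by apply: kern_sum => // x; rewrite mulr_ge0 ?distr_ge0.
rewrite exchange_big/=.
(* Chain rule: each joint kernel factors, and the factor from [mu] and [nu] does not depend on
   [y]. *)
under eq_bigr => x _.
  under eq_bigr => y _ do rewrite kernM ?distr_ge0//.
  rewrite -ge0_sume_distrr; last by move=> *; exact: kern_ge0.
  over.
apply: (leA_trans (t := \sum_x kern a (mu x) (nu x) * expA d)).
  apply: leA_sum => x; apply: leAM; first exact: kern_ge0.
  by move: (hAB x); rewrite renyi_logA logA_le ?kernS_ge0.
rewrite -ge0_sume_distrl; last by move=> *; exact: kern_ge0.
by rewrite ![_ * expA d]muleC; apply: leAM => //; exact: expA_ge0.
Qed.

End FiniteOrder.

(** * Divergence of infinite order *)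

Section InfiniteOrder.
Variable R : realType.
Local Open Scope ereal_scope.
Local Open Scope classical_set_scope.

Lemma ratio_le (x y r : R) : (0 <= x)%R -> (0 <= y)%R ->
  (lne (x%:E / y%:E) <= r%:E) = (x <= expR r * y)%R.
Proof.
move=> x0 y0; rewrite -lee_expeR lneK_ge0 ?mule_ge0 ?inve_ge0//.
rewrite /= inver; case: eqVneq => [->|yn0].
  rewrite mulr0; move: x0; rewrite le_eqVlt => /predU1P[<-|x0].
    by rewrite mul0e lexx lee_fin expR_ge0.
  by rewrite gt0_muley// leNgt ltry leNgt x0.
by rewrite -EFinM lee_fin ler_pdivrMr// lt0r yn0.
Qed.

(** This linear form also covers zeros of [nu]; sums and products of such inequalities replace the
    power inequalities of finite order. *)
Lemma renyi_oo_le T (mu nu : distr R T) (r : R) :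
  renyi +oo mu nu <= r%:E <-> (forall x, mu x <= expR r * nu x)%R.
Proof.
split=> [h x|h].
  rewrite -ratio_le ?distr_ge0//; apply: le_trans h; apply: ereal_sup_ubound.
  by exists x.
by apply: ge_ereal_sup => _ [x _ <-]; rewrite ratio_le ?distr_ge0.
Qed.

(** A negative bound [r] would give, after summation over all outcomes, [1 <= expR r < 1]. *)
Lemma renyi_ge0_oo T (mu nu : distr R T) : 0 <= renyi +oo mu nu.
Proof.
rewrite leNgt; apply/negP => lt0.
(* The supremum could a priori be [-oo]; any negative real then serves as [r]. *)
have [r r0 h] : exists2 r, (r < 0)%R & renyi +oo mu nu <= r%:E.
  case: (renyi +oo mu nu) lt0 => [r||]//; first by move=> r0; exists r.
  by exists (-1)%R; rewrite ?ltrN10 ?leNye.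
have := ler_sum (index_enum T) (P := predT) (fun x _ => (renyi_oo_le mu nu r).1 h x).
rewrite -mulr_sumr !distr_sum1 mulr1 leNgt => /negP; apply.
by rewrite expR_lt1.
Qed.

Lemma renyi_refl_oo T (mu : distr R T) : renyi +oo mu mu = 0.
Proof.
apply/eqP; rewrite eq_le renyi_ge0_oo andbT; apply/renyi_oo_le => x.
by rewrite expR0 mul1r.
Qed.

Lemma renyi_bind_oo T U (mu nu : distr R T) (A B : T -> distr R U) e d :
  0 <= e -> 0 <= d -> renyi +oo mu nu <= e ->
  (forall x, renyi +oo (A x) (B x) <= d) ->
  renyi +oo (dbind mu A) (dbind nu B) <= e + d.
Proof.
(* Nonnegativity excludes [-oo], and an infinite [e] or [d] makes the bound trivial. *)
case: e d => [e||] [d||]// _ _; rewrite ?addey ?addye ?leey//.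
rewrite -EFinD => /renyi_oo_le h hAB; apply/renyi_oo_le => y.
rewrite !ffunE mulr_sumr; apply: ler_sum => x _.
rewrite expRD mulrACA ler_pM ?distr_ge0//.
exact: (renyi_oo_le _ _ _).1.
Qed.

End InfiniteOrder.

(** * Properties common to all orders, and the chain rule *)

Section RenyiProperties.
Variables (R : realType) (alpha : \bar R).
Hypotheses (alpha_ge0 : (0 <= alpha)%E) (alpha_neq1 : alpha <> 1%E).
Local Open Scope ereal_scope.
Local Open Scope classical_set_scope.

Lemma renyi_ge0 T (mu nu : distr R T) : 0 <= renyi alpha mu nu.
Proof.
case: alpha alpha_ge0 alpha_neq1 => [a|_ _|//]; last exact: renyi_ge0_oo.
by move=> a0 a1; apply: renyi_ge0_fin => //; apply/eqP => E; rewrite E in a1.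
Qed.

Lemma renyi_refl T (mu : distr R T) : renyi alpha mu mu = 0.
Proof.
case: alpha alpha_ge0 alpha_neq1 => [a|_ _|//]; last exact: renyi_refl_oo.
by move=> a0 a1; apply: renyi_refl_fin => //; apply/eqP => E; rewrite E in a1.
Qed.

Lemma renyi_bind T U (mu nu : distr R T) (A B : T -> distr R U) e d :
  0 <= e -> 0 <= d -> renyi alpha mu nu <= e ->
  (forall x, renyi alpha (A x) (B x) <= d) ->
  renyi alpha (dbind mu A) (dbind nu B) <= e + d.
Proof.
case: alpha alpha_ge0 alpha_neq1 => [a|_ _|//]; last exact: renyi_bind_oo.
by move=> a0 a1; apply: renyi_bind_fin => //; apply/eqP => E; rewrite E in a1.
Qed.

Lemma renyi_tens n m (mu nu : distr R 'rV[bool]_n) (mu' nu' : distr R 'rV[bool]_m)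
    e d : 0 <= e -> 0 <= d -> renyi alpha mu nu <= e ->
  renyi alpha mu' nu' <= d ->
  renyi alpha (dtens mu mu') (dtens nu nu') <= e + d.
Proof.
(* A product is two successive draws followed by a Dirac distribution, so the composition bound
   applies. *)
have E (ka : distr R 'rV[bool]_n) (ka' : distr R 'rV[bool]_m) :
    dtens ka ka' = dbind ka (fun x => dbind ka' (fun y => ddirac (row_mx x y))).
  apply: distrP => w; rewrite !ffunE (bigD1 (lsubmx w))//= ffunE.
  rewrite (bigD1 (rsubmx w))//= ffunE hsubmxK eqxx mulr1.
  rewrite big1 ?addr0 => [|y /negbTE yw]; last first.
    rewrite ffunE; case: eqP => [/(congr1 rsubmx)|]; last by rewrite mulr0.
    by rewrite row_mxKr => /esym/eqP; rewrite yw.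
  rewrite big1 ?addr0// => x /negbTE xw; rewrite ffunE big1 ?mulr0// => y _.
  rewrite ffunE; case: eqP => [/(congr1 lsubmx)|]; last by rewrite mulr0.
  by rewrite row_mxKl => /esym/eqP; rewrite xw.
move=> e0 d0 h h'; rewrite !E; apply: renyi_bind => // x.
rewrite -[d]adde0; apply: renyi_bind => // y.
by rewrite renyi_refl.
Qed.

Lemma chain_cost_le p q e d e' d' : e <= e' -> d <= d' ->
  chain_cost alpha p q e d <= chain_cost alpha p q e' d'.
Proof.
case: alpha alpha_ge0 alpha_neq1 => [a|_ _|//].
  by move=> a0 a1; apply: chain_cost_le_fin => //; apply/eqP => E; rewrite E in a1.
move=> ee dd; rewrite /chain_cost ge_max !le_max.
by apply/andP; split; apply/orP; [left|right]; exact: leeD.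
Qed.

Lemma bitE (x : 'rV[bool]_1) : x = bit (x 0 0)%R.
Proof. by apply/rowP => i; rewrite !mxE ord1. Qed.

Lemma sume_row_bit m (F : 'rV[bool]_(1 + m) -> \bar R) :
  \sum_w F w = \sum_v F (row_mx (bit true) v) + \sum_v F (row_mx (bit false) v).
Proof.
rewrite (reindex (fun bv : bool * 'rV[bool]_m => row_mx (bit bv.1) bv.2))/=.
  by rewrite -(pair_big xpredT xpredT (fun b v => F (row_mx (bit b) v)))/= big_bool.
exists (fun w => (lsubmx w 0%R 0%R, rsubmx w)) => [[b v] _|w _] /=.
  by rewrite row_mxKl row_mxKr mxE.
by rewrite -bitE hsubmxK.
Qed.

(** Disintegration along the first bit: [f1] and [f0] are the conditional laws, arbitrary where
    their weight is zero. *)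
Definition mixes (p : {i01 R}) m (f1 f0 : distr R 'rV[bool]_m)
    (f : distr R 'rV[bool]_(1 + m)) :=
  forall b v, f (row_mx (bit b) v) =
    (if b then p%:num * f1 v else (1 - p%:num) * f0 v)%R.

(** The chain rule. At finite order [kern] is multiplicative; at infinite order the logarithm of the
    ratio is additive. Both then split by the first bit. *)
Lemma renyi_mixes p q m (f1 f0 g1 g0 : distr R 'rV[bool]_m) f g :
  mixes p f1 f0 f -> mixes q g1 g0 g ->
  renyi alpha f g =
  chain_cost alpha p q (renyi alpha f1 g1) (renyi alpha f0 g0).
Proof.
move=> hf hg; have onem (r : {i01 R}) : (0 <= 1 - r%:num)%R by rewrite subr_ge0.
case: alpha alpha_ge0 alpha_neq1 => [a a0 a1|_ _|//].
  have {}a1 : a != 1%R by apply/eqP => E; rewrite E in a1.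
  rewrite chain_cost_logA !renyi_logA// !logAK ?kernS_ge0// /kernS sume_row_bit.
  congr (logA _ (_ + _)).
    under eq_bigr => v _ do rewrite hf hg kernM ?distr_ge0//.
    by rewrite ge0_sume_distrr// => *; exact: kern_ge0.
  under eq_bigr => v _ do rewrite hf hg kernM ?distr_ge0//.
  by rewrite ge0_sume_distrr// => *; exact: kern_ge0.
have M (r s x y : R) : (0 <= r)%R -> (0 <= s)%R -> (0 <= x)%R -> (0 <= y)%R ->
    lne ((r * x)%:E / (s * y)%:E) = lne (r%:E / s%:E) + lne (x%:E / y%:E).
  move=> r0 s0 x0 y0; rewrite -lneM_ge0 ?mule_ge0 ?inve_ge0//; congr lne.
  rewrite !EFinM inveM; first by rewrite muleACA.
  by rewrite inveM_defE/= !ltry !lee_fin s0 y0 !implybT.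
rewrite /chain_cost /renyi; apply/eqP; rewrite eq_le; apply/andP; split.
  apply: ge_ereal_sup => _ [w _ <-]; rewrite -(hsubmxK w) [lsubmx w]bitE hf hg le_max.
  case: (lsubmx w _ _); rewrite M ?distr_ge0//; apply/orP; [left|right];
    by apply: leeD => //; apply: ereal_sup_ubound; eexists.
have S b c r s (x y : distr R 'rV[bool]_m) : (0 <= r)%R -> (0 <= s)%R ->
    (forall v, f (row_mx (bit b) v) = (r * x v)%R) ->
    (forall v, g (row_mx (bit b) v) = (s * y v)%R) -> c = lne (r%:E / s%:E) ->
    c + ereal_sup (range (fun v => lne ((x v)%:E / (y v)%:E))) <=
    ereal_sup (range (fun w => lne ((f w)%:E / (g w)%:E))).
  move=> r0 s0 hx hy ->.
  (* The supremum over a finite set is attained, so the possibly infinite [c] is added to a single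
     term. *)
  have [v _ ->] : exists2 v, True & ereal_sup (range (fun v => lne ((x v)%:E / (y v)%:E)))
      = lne ((x v)%:E / (y v)%:E).
    have [|v _ hv] := arg_maxP (P := xpredT) (i0 := 0%R)
      (fun v => lne ((x v)%:E / (y v)%:E)); first by [].
    exists v => //; apply/eqP; rewrite eq_le; apply/andP; split.
      by apply: ge_ereal_sup => _ [u _ <-]; exact: hv.
    by apply: ereal_sup_ubound; exists v.
  rewrite -M ?distr_ge0// -hx -hy; apply: ereal_sup_ubound.
  by eexists.
rewrite ge_max; apply/andP; split.
  by apply: (S true _ p%:num q%:num) => // v; rewrite ?hf ?hg.
by apply: (S false _ (1 - p%:num)%R (1 - q%:num)%R) => // v; rewrite ?hf ?hg.
Qed.

Lemma renyi_max_le n m (A B : BStoch R n m) e :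
  renyi_max alpha A B <= e <->
  forall u, renyi alpha ((A : stoch R n m) u) ((B : stoch R n m) u) <= e.
Proof.
split=> [h u|h]; last by apply: bigmax_le => //; exact: leNye.
by apply: le_trans h; exact: le_bigmax.
Qed.

Lemma renyi_max_ge0 n m (A B : BStoch R n m) : 0 <= renyi_max alpha A B.
Proof.
apply: le_trans (renyi_ge0 ((A : stoch R n m) 0%R) ((B : stoch R n m) 0%R)) _.
exact: le_bigmax.
Qed.

End RenyiProperties.

(** * Conditional circuits and conditional distributions *)

Section Conditionals.
Variable R : realType.

Lemma rV0_eq (T : Type) (u v : 'rV[T]_0) : u = v.
Proof. by apply/rowP => -[]. Qed.

(* [1 + (n + m)] and [1 + n + m] are convertible, so no cast is needed. *)
Lemma row_mxA1 (T : Type) n m (x : 'rV[T]_1) (u : 'rV[T]_n) (v : 'rV[T]_m) :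
  row_mx (row_mx x u) v = row_mx x (row_mx u v) :> 'rV[T]_(1 + (n + m)).
Proof. by rewrite [RHS]row_mxA castmx_id. Qed.

Lemma sum_dtens3 n m k (d : distr R 'rV[bool]_n) (f : distr R 'rV[bool]_m)
    (g : distr R 'rV[bool]_k) (F : 'rV[bool]_(n + m + k) -> R) :
  \sum_w dtens (dtens d f) g w * F w =
  \sum_x d x * \sum_u f u * \sum_v g v * F (row_mx (row_mx x u) v).
Proof.
rewrite !sum_row_mx; apply: eq_bigr => x _; rewrite mulr_sumr.
apply: eq_bigr => u _; rewrite !mulr_sumr; apply: eq_bigr => v _.
by rewrite !ffunE !row_mxKl !row_mxKr !mulrA.
Qed.

(** The sample that is not selected has total mass 1 and integrates out. *)
Lemma sum_pick m (f g : distr R 'rV[bool]_m) b z :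
  \sum_u f u * (\sum_v g v * (z == if b then u else v)%:R) =
  if b then f z else g z.
Proof.
case: b.
  rewrite (bigD1 z)//= eqxx -mulr_suml distr_sum1 !mulr1 big1 ?addr0// => u.
  by rewrite eq_sym => /negbTE ->; rewrite -mulr_suml !mulr0.
rewrite -mulr_suml distr_sum1 mul1r (bigD1 z)//= eqxx mulr1.
by rewrite big1 ?addr0// => v; rewrite eq_sym => /negbTE ->; rewrite mulr0.
Qed.

Variable ifT : forall n, term R (1 + n + n) n.
Hypothesis sem_ifT : forall n (x : 'rV[bool]_1) (u v : 'rV[bool]_n),
  (sem (ifT n) : stoch R (1 + n + n) n) (row_mx (row_mx x u) v)
  = ddirac (if x 0 0 then u else v).

Definition ite m (w : 'rV[bool]_(1 + m + m)) :=
  if lsubmx (lsubmx w) 0 0 then rsubmx (lsubmx w) else rsubmx w.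

Lemma iteE m (x : 'rV[bool]_1) (u v : 'rV[bool]_m) :
  ite (row_mx (row_mx x u) v) = if x 0 0 then u else v.
Proof. by rewrite /ite !row_mxKl !row_mxKr. Qed.

Lemma sem_ifT_determ m : sem (ifT m) = determ R (@ite m).
Proof.
apply/ffunP => w; rewrite -(hsubmxK w) -(hsubmxK (lsubmx w)).
by rewrite [LHS]sem_ifT ffunE iteE.
Qed.

Lemma sem_ifmax n n' m (f1 : term R n m) (f0 : term R n' m)
    (x : 'rV[bool]_1) u v :
  (sem (Tcomp (Ttens (Ttens (Tid 1) f1) f0) (ifT m)) : stoch R _ _)
    (row_mx (row_mx x u) v) =
  if x 0 0 then (sem f1 : stoch R _ _) u else (sem f0 : stoch R _ _) v.
Proof.
apply: distrP => z; rewrite /= sem_ifT_determ ffunE ffunE.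
under eq_bigr do rewrite determE.
rewrite ffunE row_mxKl row_mxKr ffunE row_mxKl row_mxKr sum_dtens3.
rewrite (bigD1 x)//= ffunE ffunE eqxx mul1r [X in _ + X]big1 ?addr0; last first.
  by move=> y /negbTE yx; rewrite !ffunE yx mul0r.
under eq_bigr => a _ do under eq_bigr => b _ do rewrite iteE.
by rewrite sum_pick; case: ifP.
Qed.

(** All wiring after the sampling stage is deterministic and collapses to one function, which leaves
    a single sum to evaluate. *)
Lemma sem_branch_determ p m (f1 f0 : Term R 0 m) :
  sem (branch ifT p f1 f0) =
  @Defs.comp (BStoch_data R) 0%N (1 + m + m)%N (1 + m)%N
    (sem (Ttens (Ttens (Flip p) f1) f0))
    (determ R (fun w => row_mx (lsubmx (lsubmx w)) (ite w))).
Proof.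
(* [c] copies the first bit and [i] applies the conditional behind it; [2 + m + m] and
   [1 + (1 + m + m)] are convertible. *)
pose c (w : 'rV[bool]_(1 + m + m)) : 'rV[bool]_(1 + (1 + m + m)) :=
  row_mx (row_mx (row_mx (lsubmx (lsubmx w)) (lsubmx (lsubmx w)) : 'rV_2)
    (rsubmx (lsubmx w))) (rsubmx w).
pose i (w : 'rV[bool]_(1 + (1 + m + m))) : 'rV[bool]_(1 + m) :=
  row_mx (lsubmx w) (ite (rsubmx w)).
have ic w : (i \o c) w = row_mx (lsubmx (lsubmx w)) (ite w).
  rewrite -(hsubmxK w) -(hsubmxK (lsubmx w)).
  move: (lsubmx (lsubmx w)) (rsubmx (lsubmx w)) (rsubmx w) => x u v.
  have cE : c (row_mx (row_mx x u) v) = row_mx x (row_mx (row_mx x u) v).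
    rewrite /c !row_mxKl !row_mxKr.
    transitivity (row_mx (row_mx x (row_mx x u)) v : 'rV[bool]_(1 + (1 + m) + m)).
      exact: (congr1 (fun y : 'rV[bool]_(1 + (1 + m)) => row_mx y v) (row_mxA1 x x u)).
    exact: (row_mxA1 x (row_mx x u) v).
  by rewrite /= cE /i !row_mxKl row_mxKr.
transitivity (@Defs.comp (BStoch_data R) _ _ _
  (@Defs.comp (BStoch_data R) 0%N (1 + m + m)%N (1 + (1 + m + m))%N
    (sem (Ttens (Ttens (Flip p) f1) f0)) (determ R c)) (determ R i)).
  rewrite /branch; apply: congr2.
    apply: congr2 => //=.
    etransitivity.
      exact: (congr1 (fun A => @Defs.tens (BStoch_data R) _ _ _ _ A (idm m)) (@determ_tens R 1 2 m m
        (fun x : 'rV[bool]_1 => row_mx x x) id)).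
    exact: (@determ_tens R (1 + m) (2 + m) m m _ id).
  transitivity (@Defs.tens (BStoch_data R) 1%N 1%N (1 + m + m)%N m
    (idm 1) (sem (ifT m))); first by [].
  rewrite sem_ifT_determ.
  exact: (@determ_tens R 1 1 _ _ id).
rewrite -(BStochP (law_compA (C := BStoch_data R) _ _ _)) determ_determ.
congr Defs.comp; apply/ffunP => w.
by rewrite ffunE [RHS]ffunE ic.
Qed.

Lemma sem_branch p m (f1 f0 : Term R 0 m) u :
  mixes p ((sem f1 : stoch R _ _) 0) ((sem f0 : stoch R _ _) 0)
    ((sem (branch ifT p f1 f0) : stoch R _ _) u).
Proof.
move=> b z; rewrite sem_branch_determ ffunE ffunE.
under eq_bigr do rewrite determE.
rewrite /= ffunE ffunE sum_dtens3.
(* Only the flip outcome [b] contributes, because the flipped bit reappears as the first output. *)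
rewrite (bigD1 (bit b))//= [X in _ + X]big1 ?addr0; last first.
  move=> y /negbTE yb; rewrite big1 ?mulr0// => v _.
  rewrite big1 ?mulr0// => w _; rewrite !row_mxKl iteE.
  case: eqP => [/(congr1 lsubmx)|]; last by rewrite mulr0.
  by rewrite !row_mxKl => /esym/eqP; rewrite yb.
have eq2 v w : (row_mx (bit b) z == row_mx (bit b) (if b then v else w)) =
    (z == if b then v else w :> 'rV[bool]_m).
  by apply/eqP/eqP => [/(congr1 rsubmx)|->//]; rewrite !row_mxKr.
under eq_bigr => v _ do under eq_bigr => w _ do
  rewrite !row_mxKl iteE mxE eq2.
rewrite sum_pick !(rV0_eq (lsubmx _) 0) !(rV0_eq (rsubmx _) 0) !ffunE.
have inj c : (bit b == bit c) = (b == c).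
  by apply/eqP/eqP => [/rowP/(_ 0)|->//]; rewrite !mxE.
rewrite !inj; case: b {eq2 inj} => /=.
  by rewrite mulr1 mulr0 addr0.
by rewrite mulr1 mulr0 add0r.
Qed.

Lemma mixes_unique p m (f1 f0 : distr R 'rV[bool]_m) f g :
  mixes p f1 f0 f -> mixes p f1 f0 g -> f = g.
Proof.
move=> hf hg; apply: distrP => w.
by rewrite -(hsubmxK w) [lsubmx w]bitE hf hg.
Qed.

Lemma mixes_ex m (f : distr R 'rV[bool]_(1 + m)) :
  exists p f1 f0, mixes p f1 f0 f.
Proof.
pose s b := \sum_v f (row_mx (bit b) v).
have s0 b : 0 <= s b by apply: sumr_ge0 => v _; exact: distr_ge0.
have s1 : s true + s false = 1.
  rewrite -(distr_sum1 f) sum_row_mx (reindex bit)/=; last first.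
    exists (fun x : 'rV[bool]_1 => x 0 0) => [b _|x _]; first by rewrite mxE.
    by rewrite -bitE.
  by rewrite big_bool.
have cond b : exists g : distr R 'rV[bool]_m,
    forall v, f (row_mx (bit b) v) = s b * g v.
  have [sb0|sb0] := eqVneq (s b) 0.
    (* When the bit [b] has probability zero, all its weights vanish and any conditional will do. *)
    exists (ddirac 0) => v; rewrite sb0 mul0r; apply/eqP.
    move/eqP: sb0; rewrite psumr_eq0 => [/allP/(_ v)|*]; last exact: distr_ge0.
    by rewrite mem_index_enum; apply.
  have g0 v : 0 <= [ffun v => f (row_mx (bit b) v) / s b] v.
    by rewrite ffunE divr_ge0 ?distr_ge0.
  have g1 : \sum_v [ffun v => f (row_mx (bit b) v) / s b] v = 1.
    by under eq_bigr do rewrite ffunE; rewrite -mulr_suml mulfV.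
  exists (Distr (distr_subproof g0 g1)) => v.
  by rewrite ffunE mulrC divfK.
have [f1 hf1] := cond true; have [f0 hf0] := cond false.
have t1 : s true <= 1 by rewrite -s1 lerDl.
exists (Itv01 (s0 true) t1), f1, f0 => -[] v; first by rewrite hf1.
by rewrite hf0/= -s1 addrC addKr.
Qed.

End Conditionals.

(** * Soundness, completeness and the isometry *)

Section Isometry.
Variables (R : realType) (alpha : \bar R).
Hypotheses (alpha_ge0 : (0 <= alpha)%E) (alpha_neq1 : alpha <> 1%E).
Variable E : forall n m, term R n m -> term R n m -> Prop.
Hypothesis E_complete : forall n m (f g : term R n m),
  eqth E f g <-> sem f = sem g.
Hypothesis E_universal : forall n m (A : BStoch R n m),
  exists f : term R n m, sem f = A.
Variable ifT : forall n, term R (1 + n + n) n.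
Hypothesis sem_ifT : forall n (x : 'rV[bool]_1) (u v : 'rV[bool]_n),
  (sem (ifT n) : stoch R (1 + n + n) n) (row_mx (row_mx x u) v)
  = ddirac (if x 0 0 then u else v).
Local Open Scope ereal_scope.
Local Open Scope classical_set_scope.

Lemma qeq_sound n m e (f g : Term R n m) : qeq alpha E ifT e f g ->
  renyi_max alpha (sem f) (sem g) <= e.
Proof.
move=> H; apply/renyi_max_le; elim: n m e f g / H.
- by move=> n m f u; rewrite renyi_refl.
- move=> m f1 g1 f0 g0 p q e d e0 d0 _ h1 _ h0 u.
  rewrite (renyi_mixes alpha_ge0 alpha_neq1 (sem_branch sem_ifT p f1 f0 u)
    (sem_branch sem_ifT q g1 g0 u)).
  exact: chain_cost_le.
- move=> n n' m f1 g1 f0 g0 e d e0 d0 _ h1 _ h0 w.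
  rewrite -(hsubmxK w) -(hsubmxK (lsubmx w)).
  rewrite [X in renyi _ X _](sem_ifmax sem_ifT).
  rewrite [X in renyi _ _ X](sem_ifmax sem_ifT).
  by case: ifP => _; rewrite le_max ?h1// h0 orbT.
- by move=> n m e f f' g g' /E_complete <- /E_complete <-.
- by move=> n m e e' f g ee _ h u; apply: le_trans ee.
- by move=> n m I e f g _ h u; apply: le_ereal_inf_tmp => _ [i _ <-].
- move=> n m k e d f f' g g' _ h _ h' u; rewrite /= !ffunE.
  (* The composition bound needs nonnegative indices; they follow from the induction hypotheses,
     since divergences are nonnegative. *)
  have d0 : 0 <= d by apply: le_trans (h' 0%R); exact: renyi_ge0.
  apply: renyi_bind => //.
  by apply: le_trans (h u); exact: renyi_ge0.
- move=> n m n' m' e d f f' g g' _ h _ h' w; rewrite /= !ffunE.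
  apply: renyi_tens => //.
    by apply: le_trans (h 0%R); exact: renyi_ge0.
  by apply: le_trans (h' 0%R); exact: renyi_ge0.
Qed.

(** Completeness of the equational theory makes every semantic identity an admissible
    replacement. *)
Lemma qeq_sem n m e (f f' g g' : term R n m) : sem f = sem f' -> sem g = sem g' ->
  qeq alpha E ifT e f g -> qeq alpha E ifT e f' g'.
Proof. by move=> ff gg; apply: qeq_subst; apply/E_complete. Qed.

Lemma qeq_complete0 m (f g : Term R 0%N m) : qeq alpha E ifT
  (renyi alpha ((sem f : stoch R 0%N m) 0%R) ((sem g : stoch R 0%N m) 0%R)) f g.
Proof.
have stoch0 k (A B : stoch R 0%N k) : A 0%R = B 0%R -> A = B.
  by move=> AB; apply/ffunP => u; rewrite (rV0_eq u 0%R).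
elim: m f g => [|m IH] f g.
  (* There is only one distribution on zero bits, so reflexivity suffices. *)
  apply: qeq_mono (qeq_sem (erefl (sem f)) _ (qeq_refl _ _ _ f)).
    exact: renyi_ge0.
  apply: stochP => u v; have S (A : stoch R 0%N 0%N) : A u v = 1%R.
    rewrite -(distr_sum1 (A u)) (bigD1 v)//= big1 ?addr0// => w.
    by rewrite (rV0_eq w v) eqxx.
  by rewrite !S.
have [p [df1 [df0 hf]]] := mixes_ex ((sem f : stoch R 0%N (1 + m)%N) 0%R).
have [q [dg1 [dg0 hg]]] := mixes_ex ((sem g : stoch R 0%N (1 + m)%N) 0%R).
have term_of (d : distr R 'rV[bool]_m) :
    exists t : Term R 0%N m, (sem t : stoch R 0%N m) 0%R = d.
  by have [t ht] := E_universal ([ffun=> d] : stoch R 0%N m); exists t; rewrite ht ffunE.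
have [f1 hf1] := term_of df1; have [f0 hf0] := term_of df0.
have [g1 hg1] := term_of dg1; have [g0 hg0] := term_of dg0.
have := qeq_chain p q (renyi_ge0 alpha_ge0 alpha_neq1 _ _)
  (renyi_ge0 alpha_ge0 alpha_neq1 _ _) (IH f1 g1) (IH f0 g0).
(* By the chain rule the cost produced by (Chain) is exactly the divergence of [f] and [g], which
   have the same semantics as the two branching circuits. *)
rewrite hf1 hg1 hf0 hg0 -(renyi_mixes alpha_ge0 alpha_neq1 hf hg).
apply: qeq_sem; apply: stoch0.
  by apply: mixes_unique _ hf; rewrite -hf1 -hf0; exact: sem_branch.
by apply: mixes_unique _ hg; rewrite -hg1 -hg0; exact: sem_branch.
Qed.

Lemma qeq_complete n m (f g : Term R n m) :
  qeq alpha E ifT (renyi_max alpha (sem f) (sem g)) f g.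
Proof.
elim: n f g => [|n IH] f g.
  apply: qeq_mono (qeq_complete0 f g).
  exact: (renyi_max_le _ _ _ _).1.
(* [c] duplicates the last [n] inputs, so that each branch receives its own copy. *)
have [c hc] := E_universal (determ R (fun w : 'rV[bool]_(1 + n) =>
  row_mx (row_mx (lsubmx w) (rsubmx w)) (rsubmx w)) : BStoch R (1 + n)%N (1 + n + n)%N).
(* [t h b] is a circuit for [h] with its first input fixed to [b]. *)
have [t tE] : exists t : Term R (1 + n)%N m -> bool -> Term R n m,
    forall h b, sem (t h b) = [ffun u => (sem h : stoch R (1 + n)%N m) (row_mx (bit b) u)].
  have ex h b : {t : Term R n m |
      sem t = [ffun u => (sem h : stoch R (1 + n)%N m) (row_mx (bit b) u)]}.
    exact/cid/E_universal.
  by exists (fun h b => sval (ex h b)) => h b; exact: svalP (ex h b).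
have decomp h : sem (Tcomp c (Tcomp (Ttens (Ttens (Tid 1) (t h true)) (t h false)) (ifT m)))
    = sem h.
  transitivity (@Defs.comp (BStoch_data R) _ _ _ (sem c) (sem (Tcomp
    (Ttens (Ttens (Tid 1) (t h true)) (t h false)) (ifT m)))); first by [].
  rewrite hc [LHS]determ_comp; apply/ffunP => w; rewrite ffunE.
  rewrite [LHS](sem_ifmax sem_ifT) !tE !ffunE -[in RHS](hsubmxK w) [in RHS](bitE (lsubmx w)).
  by case: (lsubmx w _ _).
have := qeq_comp (qeq_refl alpha E ifT c)
  (qeq_ifmax (renyi_max_ge0 alpha_ge0 alpha_neq1 _ _)
  (renyi_max_ge0 alpha_ge0 alpha_neq1 _ _) (IH (t f true) (t g true))
  (IH (t f false) (t g false))).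
move/(qeq_sem (decomp f) (decomp g)); apply: qeq_mono.
(* Prefixing [c] costs 0, and each branch takes its maximum over part of the inputs. *)
rewrite add0e ge_max; apply/andP; split; apply/renyi_max_le => u;
  rewrite !tE !ffunE; exact: (renyi_max_le _ _ _ _).1.
Qed.

(** Completeness puts the divergence among the derivable bounds and soundness puts it below them
    all, so the infimum is attained. *)
Lemma syn_distE n m (f g : term R n m) :
  syn_dist alpha E ifT f g = renyi_max alpha (sem f) (sem g).
Proof.
apply/eqP; rewrite eq_le; apply/andP; split.
  apply: ereal_inf_lbound; split; first exact: renyi_max_ge0.
  exact: qeq_complete.
by apply: le_ereal_inf_tmp => e [_ /qeq_sound].
Qed.

End Isometry.

(** * The isomorphism of categories *)

Section Isomorphism.
Variable R : realType.
Variable E : forall n m, term R n m -> term R n m -> Prop.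
Hypothesis E_complete : forall n m (f g : term R n m),
  eqth E f g <-> sem f = sem g.
Hypothesis E_universal : forall n m (A : BStoch R n m),
  exists f : term R n m, sem f = A.

Definition syn_sem n m (f : Syn E n m) : BStoch R n m := sem (repr f).

Lemma syn_semE n m (f : term R n m) : syn_sem (synpi E f) = sem f.
Proof. exact/E_complete/eqth_repr. Qed.

(** Universality provides a preimage term, selected by choice; completeness makes its class
    unique. *)
Lemma syn_sem_bij n m : bijective (@syn_sem n m).
Proof.
have ex A : {f : term R n m | sem f = A} by exact/cid/E_universal.
exists (fun A => synpi E (sval (ex A))) => [f|A].
  rewrite -[RHS]reprK; apply/synpiP/E_complete.
  exact: svalP (ex _).
by rewrite syn_semE (svalP (ex A)).
Qed.

(** Each operation of [Syn] is the class of a term, so preservation reduces to the equations of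
    [sem]. The definition is transparent so that its map unfolds to [syn_sem]. *)
Definition syn_iso : smc_iso (Syn E) (BStoch R).
Proof.
exists syn_sem.
- exact: syn_sem_bij.
- by move=> n; rewrite syn_semE.
- by move=> n m k f g; rewrite syn_semE.
- by move=> n m n' m' f g; rewrite syn_semE.
- by move=> n m; rewrite syn_semE.
Defined.

End Isomorphism.

Theorem theorem5p5 (R : realType) (alpha : \bar R)
    (alpha_ge0 : (0 <= alpha)%E) (alpha_neq1 : alpha <> 1%E)
    (TCirc : forall n m, term R n m -> term R n m -> Prop)
    (TCirc_complete : forall n m (f g : term R n m),
      eqth TCirc f g <-> sem f = sem g)
    (TCirc_universal : forall n m (A : BStoch R n m),
      exists f : term R n m, sem f = A)
    (ifT : forall n, term R (1 + n + n) n)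
    (sem_ifT : forall n (x : 'rV[bool]_1) (u v : 'rV[bool]_n),
      (sem (ifT n) : stoch R (1 + n + n) n) (row_mx (row_mx x u) v)
      = ddirac (if x 0 0 then u else v)) :
  exists F : smc_iso (Syn TCirc) (BStoch R),
    (forall n m (f : term R n m), F n m (synpi TCirc f) = sem f) /\
    (forall n m (f g : term R n m),
      syn_dist alpha TCirc ifT f g = renyi_max alpha (sem f) (sem g)).
Proof.
exists (syn_iso TCirc_complete TCirc_universal); split => n m f.
  exact: syn_semE.
by move=> g; exact: syn_distE.
Qed.
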